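(* Let $k$ be a field, $n\le m$, $R=k[x_{ij}\mid 1\le i\le n,\ 1\le j\le m]$, $M=(x_{ij})$ the $n\times m$ matrix of variables, and $<$ any term order on $R$. Then the sparse Eagon–Northcott complex $E_\bullet^<$ has differentials of the form $$g^{*(\alpha)}\otimes f_I\ \mapsto\ \sum_{\substack{i\in\operatorname{supp}(\alpha)\\ j\in\mathbf b_i}}\operatorname{sgn}(j\in I)\,x_{ij}\,g^{*(\alpha-\epsilon_i)}\otimes f_{I\setminus j}$$ for the basis elements in homological degree $\ge2$, where $\operatorname{mdeg}(g^{*(\alpha)}\otimes f_I)=x_{1\mathbf b_1}\cdots x_{n\mathbf b_n}$, and $$f_I\mapsto\operatorname{in}_<([I])$$ in homological degree $1$.
   Context: For an $n$-subset $I\subseteq[m]$, $[I]$ is the maximal minor of $M$ on the columns $I$ and $\operatorname{in}_<([I])$ is its lead term (taken with its coefficient $\pm1$ when it occurs as an entry of the differential). Eagon–Northcott complex $E_\bullet$: let $F=R^m$ with basis $f_1,\dots,f_m$ and $G=R^n$ with basis $g_1,\dots,g_n$. Then $E_0=R$, $E_\ell=D_{\ell-1}(G^* )\otimes\bigwedge^{n+\ell-1}F$ for $1\le\ell\le m-n+1$ ($D$ denotes divided powers). A basis of $E_\ell$ is given by the $g^{*(\alpha)}\otimes f_I=g_1^{*(\alpha_1)}\cdots g_n^{*(\alpha_n)}\otimes f_{i_1}\wedge\cdots\wedge f_{i_{n+\ell-1}}$ with $\alpha\in\mathbb Z_{\ge0}^n$, $|\alpha|=\ell-1$, $I=\{i_1<\dots<i_{n+\ell-1}\}\subseteq[m]$.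 The differential is $f_I\mapsto[I]$ in degree $1$ and $g^{*(\alpha)}\otimes f_I\mapsto\sum_{i\in\operatorname{supp}(\alpha)}\sum_{j\in I}\operatorname{sgn}(j\in I)x_{ij}\,g^{*(\alpha-\epsilon_i)}\otimes f_{I\setminus j}$ in degrees $\ge2$, where $\operatorname{supp}(\alpha)=\{i\mid\alpha_i>0\}$, $\epsilon_i$ is the $i$-th unit vector, and $\operatorname{sgn}(j\in I)=(-1)^{p+1}$ if $j$ is the $p$-th smallest element of $I$. Sparse Eagon–Northcott complex $E^<_\bullet$: the complex obtained by homogenizing $E_\bullet$ with respect to $<$ using a new variable $t$ and then setting $t=0$. Explicitly, it has the same free modules and bases; multidegrees (monomials of $R$) are assigned inductively: $\operatorname{mdeg}(f_I)$ is the lead monomial of $[I]$ and $d^<(f_I)=\operatorname{in}_<([I])$; if $e$ is a basis element in homological degree $\ge2$ with $d^E(e)=\sum_s\pm y_s e_s$ ($y_s$ variables, $e_s$ basis elements), then $\operatorname{mdeg}(e)$ is the $<$-largest of the monomials $y_s\operatorname{mdeg}(e_s)$, and $d^<(e)$ consists of exactly those terms $\pm y_se_s$ with $y_s\operatorname{mdeg}(e_s)=\operatorname{mdeg}(e)$. (By a result of Boocher, $E^<_\bullet$ is the minimal free resolution of $R/\operatorname{in}_<I_n(M)$.) The multidegree of $g^{*(\alpha)}\otimes f_I$ is written $x_{1\mathbf b_1}\cdots x_{n\mathbf b_n}$ with $x_{i\mathbf b_i}=\prod_{b\in\mathbf b_i}x_{ib}$, where $\mathbf b_1,\dots,\mathbf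 b_n$ partition $I$ and $|\mathbf b_i|=\alpha_i+1$. *)

(* Defs.v *)
From HB Require Import structures.
From mathcomp Require Import all_boot all_order all_algebra.
From mathcomp Require Export mpoly.

Set Implicit Arguments.
Unset Strict Implicit.
Unset Printing Implicit Defensive.

Import GRing.Theory.
Local Open Scope ring_scope.

(* [le u v] is the non-strict order on monomials, identified with their
   exponent vectors (so the product of monomials is [+%MM] and 1 is [0%MM]). *)
Definition term_order (N : nat) (le : rel 'X_{1..N}) : Prop :=
  [/\ reflexive le, antisymmetric le, transitive le, total le &
      (forall u, le 0%MM u) /\
      (forall u v w, le u v -> le (u + w)%MM (v + w)%MM)].

Definition mmax (N : nat) (le : rel 'X_{1..N}) (u v : 'X_{1..N}) :=
  if le u v then v else u.

(* The starting value [0%MM] of this and of the other iterated maxima below is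
   harmless, 1 being the least monomial of a term order. *)
Definition lmon (k : fieldType) (N : nat) (le : rel 'X_{1..N})
    (p : {mpoly k[N]}) : 'X_{1..N} :=
  \big[mmax le/0%MM]_(u <- msupp p) u.

Definition lterm (k : fieldType) (N : nat) (le : rel 'X_{1..N})
    (p : {mpoly k[N]}) : {mpoly k[N]} :=
  p@_(lmon le p) *: 'X_[lmon le p].

(* The free R-module on a finite basis [B].  The regular algebra [R^o] makes
   R itself, rather than its own base ring, act on the coordinates. *)
Definition freemod (R : comNzRingType) (B : finType) := {ffun B -> R^o}.

Definition linext (R : comNzRingType) (B C : finType)
    (D : B -> freemod R C) (v : freemod R B) : freemod R C :=
  \sum_(e : B) (v e : R) *: D e.

(* Let the basis elements [c] of a free module have multidegrees [w c].  The
   multidegree of a vector is the largest monomial [u * w c] over all its terms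
   [u c]; homogenizing multiplies every term of strictly smaller multidegree by
   a positive power of [t], so that exactly the terms of largest multidegree
   survive at [t = 0]. *)
Definition vmdeg (k : fieldType) (N : nat) (le : rel 'X_{1..N}) (C : finType)
    (w : C -> 'X_{1..N}) (v : freemod {mpoly k[N]} C) : 'X_{1..N} :=
  \big[mmax le/0%MM]_(c : C)
    \big[mmax le/0%MM]_(u <- msupp (v c : {mpoly k[N]})) (u + w c)%MM.

Definition vinit (k : fieldType) (N : nat) (le : rel 'X_{1..N}) (C : finType)
    (w : C -> 'X_{1..N}) (v : freemod {mpoly k[N]} C) :
    freemod {mpoly k[N]} C :=
  [ffun c => \sum_(u <- msupp (v c : {mpoly k[N]})
                    | (u + w c)%MM == vmdeg le w v)
               (v c : {mpoly k[N]})@_u *: ('X_[u] : {mpoly k[N]})].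

(* Row and column indices start at 0. *)
Definition xvar (k : fieldType) (n m : nat) (i : 'I_n) (j : 'I_m) :
    {mpoly k[n * m]} := 'X_(mxvec_index i j).

Definition genmat (k : fieldType) (n m : nat) : 'M[{mpoly k[n * m]}]_(n, m) :=
  \matrix_(i < n, j < m) xvar k i j.

(* Meant for [#|I| = n]: the [c]-th column is the column of the generic matrix
   indexed by the [c]-th smallest element of [I]. *)
Definition maxminor (k : fieldType) (n m : nat) (I : {set 'I_m}) :
    {mpoly k[n * m]} :=
  \det (\matrix_(i < n, c < n) [seq genmat k n m i j | j <- enum I]`_c).

(* The basis of E_{ell+1}: the pairs (alpha, I) with |alpha| = ell and
   |I| = n + ell, standing for g^{*(alpha)} (x) f_I. *)
Definition EN_gen (n m ell : nat) : finType :=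
  {p : 'X_{1..n < ell.+1} * {set 'I_m} |
    (mdeg p.1 == ell) && (#|p.2| == n + ell)%N}.

Definition gexp (n m ell : nat) (e : EN_gen n m ell) : 'X_{1..n} :=
  (val e).1.

Definition gset (n m ell : nat) (e : EN_gen n m ell) : {set 'I_m} :=
  (val e).2.

Definition EN_basis (n m ell : nat) : finType :=
  if ell is l.+1 then EN_gen n m l else unit.

Definition EN (k : fieldType) (n m ell : nat) :=
  freemod {mpoly k[n * m]} (EN_basis n m ell).

(* The basis element 1 of E_0 = R. *)
Definition EN_one (k : fieldType) (n m : nat) : EN k n m 0 := [ffun=> 1].

(* g^{*(alpha)} (x) f_I as an element of E_{ell+1}; it is 0 when (alpha, I)
   does not have the right degrees. *)
Definition EN_vec (k : fieldType) (n m ell : nat)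
    (alpha : 'X_{1..n}) (I : {set 'I_m}) : EN k n m ell.+1 :=
  [ffun e : EN_gen n m ell => ((gexp e == alpha) && (gset e == I))%:R].

Definition position (m : nat) (j : 'I_m) (I : {set 'I_m}) : nat :=
  #|[set i in I | (i <= j)%N]|.

Definition sgn (k : fieldType) (n m : nat) (j : 'I_m) (I : {set 'I_m}) :
    {mpoly k[n * m]} :=
  (-1) ^+ (position j I).+1.

Definition EN_d_basis (k : fieldType) (n m ell : nat) :
    EN_basis n m ell.+1 -> EN k n m ell :=
  match ell return EN_basis n m ell.+1 -> EN k n m ell with
  | 0 => fun e : EN_gen n m 0 => maxminor k n (gset e) *: EN_one k n m
  | l.+1 => fun e : EN_gen n m l.+1 =>
      \sum_(i < n | (0 < gexp e i)%N) \sum_(j in gset e)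
        (sgn k n j (gset e) * xvar k i j) *:
          EN_vec k l (gexp e - U_(i))%MM (gset e :\ j)
  end.

Definition EN_d (k : fieldType) (n m ell : nat) :
    EN k n m ell.+1 -> EN k n m ell :=
  linext (@EN_d_basis k n m ell).

Fixpoint EN_mdeg (k : fieldType) (n m : nat) (le : rel 'X_{1..n * m})
    (ell : nat) : EN_basis n m ell -> 'X_{1..n * m} :=
  match ell return EN_basis n m ell -> 'X_{1..n * m} with
  | 0 => fun=> 0%MM
  | l.+1 => fun e => vmdeg le (@EN_mdeg k n m le l) (EN_d_basis k e)
  end.

(* The free modules and bases are those of the Eagon-Northcott complex. *)
Definition sEN_d (k : fieldType) (n m : nat) (le : rel 'X_{1..n * m})
    (ell : nat) : EN k n m ell.+1 -> EN k n m ell :=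
  linext (fun e => vinit le (@EN_mdeg k n m le ell) (EN_d_basis k e)).

(* Main.v *)
(** Distribute the columns of [I] over the rows, [a_i + 1] of them to row [i];
    such a placement is a tuple (b_1, ..., b_n) as in the theorem, and distinct
    placements have distinct monomials x_{1 b_1} ... x_{n b_n}.  By induction on
    the homological degree, mdeg(g^{*(a)} (x) f_I) is the largest monomial of an
    admissible placement: the monomials of a maximal minor are those of the
    bijective placements, and adding column [j] to row [i] turns the placements
    admissible for (a - e_i, I \ j) into those for (a, I) which send [j] to [i].
    Hence x_ij * mdeg(g^{*(a - e_i)} (x) f_{I \ j}) is always the monomial of a
    placement sending [j] to [i], and by maximality it equals the multidegree
    of g^{*(a)} (x) f_I exactly when [j] lies in b_i. *)

Require Import Defs.
From HB Require Import structures.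
From mathcomp Require Import all_boot all_order all_fingroup all_algebra.

Set Implicit Arguments.
Unset Strict Implicit.
Unset Printing Implicit Defensive.

Import GRing.Theory.
Local Open Scope ring_scope.

(** * Iterated maxima with respect to a term order *)

Section TermOrder.
Variables (N : nat) (le : rel 'X_{1..N}).
Hypothesis hle : term_order le.
Implicit Types u v w x y : 'X_{1..N}.

Lemma term_order_refl u : le u u.
Proof. by case: hle. Qed.

Lemma term_order_anti u v : le u v -> le v u -> u = v.
Proof. by case: hle => _ anti _ _ _ uv vu; apply: anti; rewrite uv vu. Qed.

Lemma term_order_trans v u w : le u v -> le v w -> le u w.
Proof. by case: hle => _ _ tr _ _; apply: tr. Qed.

Lemma term_order_total u v : le u v || le v u.
Proof. by case: hle. Qed.

Lemma term_order_ge0 u : le 0%MM u.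
Proof. by case: hle => _ _ _ _ []. Qed.

Lemma term_order_add2r w u v : le u v -> le (u + w)%MM (v + w)%MM.
Proof. by case: hle => _ _ _ _ [_]; apply. Qed.

Lemma mmax_le u v w : le (mmax le u v) w = le u w && le v w.
Proof.
rewrite /mmax; case: ifPn => uv.
  apply/idP/andP => [vw|[]//]; split=> //; exact: term_order_trans uv vw.
have vu : le v u by have := term_order_total u v; rewrite (negPf uv).
apply/idP/andP => [uw|[]//]; split=> //; exact: term_order_trans vu uw.
Qed.

Lemma bigmmax_le (T : Type) (s : seq T) (F : T -> 'X_{1..N}) w :
  le (\big[mmax le/0%MM]_(i <- s) F i) w = all (fun i => le (F i) w) s.
Proof.
elim: s => [|i s IHs]; first by rewrite big_nil term_order_ge0.
by rewrite big_cons mmax_le IHs.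
Qed.

(** The first alternative accounts for the starting value, which may survive even when [s] is
    nonempty. *)
Lemma bigmmax_attained (T : eqType) (s : seq T) (F : T -> 'X_{1..N}) :
  \big[mmax le/0%MM]_(i <- s) F i = 0%MM \/
  exists2 i, i \in s & \big[mmax le/0%MM]_(i <- s) F i = F i.
Proof.
elim: s => [|i s IHs]; first by left; rewrite big_nil.
rewrite big_cons {1 3}/mmax; case: ifP => _; last first.
  by right; exists i; rewrite ?mem_head.
case: IHs => [|[j js ->]]; first by left.
by right; exists j; rewrite // inE js orbT.
Qed.

Lemma mmaxu0 u : mmax le u 0%MM = u.
Proof.
rewrite /mmax; case: ifP => // u0.
exact: term_order_anti (term_order_ge0 u) u0.
Qed.

End TermOrder.

(** * Multidegree and initial part of a vector in a free module *)

Section VectorDegree.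
Variables (k : fieldType) (N : nat) (le : rel 'X_{1..N}) (C : finType).
Hypothesis hle : term_order le.
Variables (w : C -> 'X_{1..N}) (v : freemod {mpoly k[N]} C).

Lemma vmdeg_ub c u : u \in msupp (v c : {mpoly k[N]}) ->
  le (u + w c)%MM (vmdeg le w v).
Proof.
move=> uv.
have := term_order_refl hle (vmdeg le w v).
rewrite {1}/vmdeg bigmmax_le // => /allP /(_ c (mem_index_enum _)).
by rewrite bigmmax_le // => /allP /(_ u uv).
Qed.

(** The way every multidegree is computed below: exhibit a term attaining [x] and bound all terms by
    [x]; antisymmetry does the rest. *)
Lemma vmdegP x :
  (exists c u, u \in msupp (v c : {mpoly k[N]}) /\ x = (u + w c)%MM) ->
  (forall c u, u \in msupp (v c : {mpoly k[N]}) -> le (u + w c)%MM x) ->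
  vmdeg le w v = x.
Proof.
move=> [c [u [uv ->]]] ub; apply: (term_order_anti hle); last exact: vmdeg_ub.
rewrite /vmdeg bigmmax_le //; apply/allP => c' _.
by rewrite bigmmax_le //; apply/allP => u' /ub.
Qed.

Lemma mcoeff_vinit c u :
  (vinit le w v c : {mpoly k[N]})@_u =
  if (u + w c)%MM == vmdeg le w v then (v c : {mpoly k[N]})@_u else 0.
Proof.
rewrite ffunE raddf_sum /=.
rewrite (eq_bigr (fun x => (v c : {mpoly k[N]})@_x *+ (x == u))); last first.
  by move=> x _; rewrite mcoeffZ mcoeffX; case: eqP; rewrite ?mulr1 ?mulr0.
have [us|us] := boolP (u \in msupp (v c : {mpoly k[N]})).
  rewrite big_mkcond (bigD1_seq u) ?msupp_uniq //= eqxx.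
  rewrite big1 ?addr0 // => x /negPf ->; by rewrite mulr0n if_same.
rewrite big_seq_cond big1 => [|x /andP[xs _]].
  by rewrite (memN_msupp_eq0 us) if_same.
by case: eqP => // xu; rewrite xu (negPf us) in xs.
Qed.

End VectorDegree.

(** * Placements of columns into rows and their monomials *)

Section Placements.
Variables (n m : nat).

(* [f j = Some i] when column [j] is in [b_i], [None] when it is in no [b_i]. *)
Definition placement := {ffun 'I_m -> option 'I_n}.
Implicit Types (f g : placement) (i : 'I_n) (j : 'I_m).
Implicit Types (a : 'X_{1..n}) (I : {set 'I_m}).

Definition fiber f i : {set 'I_m} := [set j | f j == Some i].

Definition pdom f : {set 'I_m} := [set j | f j].

(** Exponent vector of x_{1 b_1} ... x_{n b_n} with b_i = [fiber f i]. *)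
Definition pmon f : 'X_{1..n * m} :=
  (\sum_(i < n) \sum_(j in fiber f i) U_(mxvec_index i j))%MM.

(** The candidates for the multidegree of the basis element (a, I): fibres of a function are
    disjoint, so these are the partitions of [I] into blocks b_i with a_i + 1 elements. *)
Definition admissible (a : 'X_{1..n}) (I : {set 'I_m}) f :=
  (pdom f = I) /\ (forall i, #|fiber f i| = (a i).+1).

Lemma mxvec_index_inj i j i' j' :
  mxvec_index i j = mxvec_index i' j' -> i = i' /\ j = j'.
Proof. by rewrite /mxvec_index => /cast_ord_inj /enum_rank_inj []. Qed.

Lemma eq_mxvec_index i j i' j' :
  (mxvec_index i j == mxvec_index i' j') = (i == i') && (j == j').
Proof.
apply/eqP/andP => [/mxvec_index_inj[-> ->]|[/eqP-> /eqP->]//]; by rewrite !eqxx.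
Qed.

Lemma pmonE f i j : pmon f (mxvec_index i j) = (f j == Some i).
Proof.
rewrite /pmon mnm_sumE (bigD1 i) //= [X in (_ + X)%N]big1 => [|i' ne]; last first.
  rewrite mnm_sumE big1 // => j' _; rewrite mnm1E eq_mxvec_index.
  by rewrite (negPf ne).
rewrite mnm_sumE addn0.
under eq_bigr do rewrite mnm1E eq_mxvec_index eqxx /=.
rewrite big_mkcond (bigD1 j) //= big1 => [|j' /negPf->]; last by rewrite if_same.
by rewrite inE eqxx addn0; case: eqP.
Qed.

(** The exponent of x_ij is 1 or 0 according to whether [j] is sent to [i], so the monomial records
    the whole placement. Equalities of multidegrees thus become equalities of placements. *)
Lemma pmon_inj : injective pmon.
Proof.
move=> f g fg; apply/ffunP => j.
have E i : (f j == Some i) = (g j == Some i).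
  by have := pmonE f i j; rewrite fg pmonE; do 2!case: eqP.
case: (f j) (g j) E => [i|] [i'|] E //.
- by move: (E i); rewrite eqxx => /esym/eqP.
- by move: (E i); rewrite eqxx.
- by move: (E i'); rewrite eqxx.
Qed.

Definition place f i j : placement := [ffun j' => if j' == j then Some i else f j'].
Definition unplace f j : placement := [ffun j' => if j' == j then None else f j'].

(** A column not yet placed contributes no variable, so nothing is overwritten and exactly the
    factor x_ij is gained. *)
Lemma pmon_place f i j : f j = None ->
  pmon (place f i j) = (U_(mxvec_index i j) + pmon f)%MM.
Proof.
move=> fj; apply/mnmP => q; case/mxvec_indexP: q => i' j'.
rewrite mnmDE mnm1E !pmonE eq_mxvec_index ffunE [j == _]eq_sym.
case: (j' =P j) => [->|_]; last by rewrite andbF.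
by rewrite fj andbT addn0 (inj_eq Some_inj).
Qed.

Lemma place_unplace f i j : f j = Some i -> place (unplace f j) i j = f.
Proof. by move=> fj; apply/ffunP => j'; rewrite !ffunE; case: eqP => [->|]. Qed.

Lemma pmon_unplace f i j : f j = Some i ->
  (U_(mxvec_index i j) + pmon (unplace f j))%MM = pmon f.
Proof.
move=> fj; rewrite -pmon_place ?place_unplace //; by rewrite ffunE eqxx.
Qed.

Lemma fiber_sub_pdom f i : fiber f i \subset pdom f.
Proof. by apply/subsetP => j; rewrite !inE => /eqP->. Qed.

Lemma bigcup_fiber f : \bigcup_(i < n) fiber f i = pdom f.
Proof.
apply/setP => j; rewrite inE; apply/bigcupP/idP => [[i _]|].
  by rewrite inE => /eqP->.
by case fj: (f j) => [i|] // _; exists i; rewrite // inE fj.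
Qed.

Lemma disjoint_fiber f i i' : i != i' -> [disjoint fiber f i & fiber f i'].
Proof.
move=> ne; rewrite -setI_eq0; apply/eqP/setP => j; rewrite !inE.
by case: (f j =P Some i) => [->|//]; rewrite (inj_eq Some_inj) (negPf ne).
Qed.

Lemma admissible_place a I f i j : (0 < a i)%N -> j \in I ->
  admissible (a - U_(i))%MM (I :\ j) f -> admissible a I (place f i j).
Proof.
move=> ai jI [dom cnt].
have fj : f j = None.
  have: (j \in pdom f) = (j \in I :\ j) by rewrite dom.
  by rewrite !inE eqxx; case: (f j).
split.
  apply/setP => j'; rewrite inE ffunE; case: eqP => [->|/eqP ne]; first by rewrite jI.
  have: (j' \in pdom f) = (j' \in I :\ j) by rewrite dom.
  by rewrite !inE ne.
move=> i'; case: (i =P i') => [<-|/eqP ne].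
  have -> : fiber (place f i j) i = j |: fiber f i.
    apply/setP => j'; rewrite !inE ffunE; case: (j' =P j) => //= _.
    by rewrite eqxx.
  (* Subtraction is truncated: a_i > 0 is what makes 1 + ((a_i - 1) + 1) equal to a_i + 1. *)
  rewrite cardsU1 inE fj /= cnt mnmBE mnm1E eqxx; by case: (a i) ai => // p; rewrite subn1.
have -> : fiber (place f i j) i' = fiber f i'.
  apply/setP => j'; rewrite !inE ffunE; case: (j' =P j) => [->|//].
  by rewrite fj (inj_eq Some_inj) (negPf ne).
by rewrite cnt mnmBE mnm1E (negPf ne) subn0.
Qed.

Lemma admissible_unplace a I f i j : (0 < a i)%N -> f j = Some i ->
  admissible a I f -> admissible (a - U_(i))%MM (I :\ j) (unplace f j).
Proof.
move=> ai fj [dom cnt]; split.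
  by apply/setP => j'; rewrite -dom !inE ffunE; case: (j' =P j).
move=> i'; rewrite mnmBE mnm1E; case: (i =P i') => [<-|/eqP ne].
  have E : fiber (unplace f j) i = fiber f i :\ j.
    by apply/setP => j'; rewrite !inE ffunE; case: (j' =P j).
  have := cardsD1 j (fiber f i); rewrite inE fj eqxx cnt E add1n => -[<-].
  by case: (a i) ai => // p _; rewrite subn1.
rewrite subn0 -cnt; apply: eq_card => j'; rewrite !inE ffunE.
case: (j' =P j) => [->|//]; by rewrite fj (inj_eq Some_inj) (negPf ne).
Qed.

End Placements.

(** * Basis elements and the matrix entries of the differential *)

Section Generators.
Variables (n m : nat).
Implicit Types (i : 'I_n) (j : 'I_m).

Lemma mdeg_gexp ell (e : EN_gen n m ell) : mdeg (gexp e) = ell.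
Proof. by case/andP: (valP e) => /eqP. Qed.

Lemma card_gset ell (e : EN_gen n m ell) : #|gset e| = (n + ell)%N.
Proof. by case/andP: (valP e) => _ /eqP. Qed.

Lemma EN_gen_inj ell (e e' : EN_gen n m ell) :
  gexp e = gexp e' -> gset e = gset e' -> e = e'.
Proof.
move=> a I; apply: val_inj; rewrite [LHS]surjective_pairing [RHS]surjective_pairing.
by congr pair => //; apply: val_inj.
Qed.

Lemma EN_gen_ex ell (a : 'X_{1..n}) (I : {set 'I_m}) :
  mdeg a = ell -> #|I| = (n + ell)%N ->
  exists e : EN_gen n m ell, gexp e = a /\ gset e = I.
Proof.
move=> da cI; have lta : (mdeg a < ell.+1)%N by rewrite da.
have P : (mdeg (BMultinom lta) == ell) && (#|I| == n + ell)%N.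
  by rewrite /= da cI !eqxx.
by exists (exist _ (BMultinom lta, I) P).
Qed.

(** The basis element [c] occurs in the Eagon-Northcott differential of [e] with the variable x_ij,
    up to sign. *)
Definition is_face ell (e : EN_gen n m ell.+1) (c : EN_gen n m ell) i j :=
  [/\ (0 < gexp e i)%N, j \in gset e,
      gexp c = (gexp e - U_(i))%MM & gset c = gset e :\ j].

Lemma face_ex ell (e : EN_gen n m ell.+1) i j :
  (0 < gexp e i)%N -> j \in gset e -> exists c, is_face e c i j.
Proof.
move=> ai jI.
have [||c [ca cI]] := @EN_gen_ex ell (gexp e - U_(i))%MM (gset e :\ j).
- have /(congr1 (@mdeg n)) : (gexp e - U_(i) + U_(i))%MM = gexp e.
    by apply: submK; apply/mnm_lepP => i'; rewrite mnm1E; case: eqP => [<-|].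
  by rewrite mdegD mdeg1 mdeg_gexp addn1 => -[].
- by have := cardsD1 j (gset e); rewrite jI card_gset addnS add1n => -[].
by exists c.
Qed.

(** The row is the only coordinate in which the exponent drops, the column the only element removed.
    So every matrix entry of the differential comes from at most one pair (i, j), without
    cancellation. *)
Lemma face_inj ell (e : EN_gen n m ell.+1) c i j i' j' :
  is_face e c i j -> is_face e c i' j' -> i = i' /\ j = j'.
Proof.
case=> ai jI ca cI [ai' jI']; rewrite ca cI => Ea EI; split.
  apply/eqP/negPn/negP => ne; move/mnmP/(_ i): Ea.
  rewrite !mnmBE !mnm1E eqxx eq_sym (negPf ne) subn0.
  by case: (gexp e i) ai => // p _; rewrite subn1 => /eqP; rewrite ltn_eqF.
apply/eqP/negPn/negP => ne; move/setP/(_ j): EI.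
by rewrite !inE eqxx ne jI.
Qed.

Variable k : fieldType.
Implicit Types S : 'I_n -> {set 'I_m}.

Definition face_coef ell (e : EN_gen n m ell) i j : {mpoly k[n * m]} :=
  sgn k n j (gset e) * xvar k i j.

(* [S] constantly [gset e] gives the Eagon-Northcott differential of [e],
   [S i = b_i] the sparse one. *)
Definition face_sum ell (S : 'I_n -> {set 'I_m}) (e : EN_gen n m ell.+1) :
    EN k n m ell.+1 :=
  \sum_(i < n | (0 < gexp e i)%N) \sum_(j in S i)
    face_coef e i j *: EN_vec k ell (gexp e - U_(i))%MM (gset e :\ j).

Lemma face_sumE ell S (e : EN_gen n m ell.+1) c :
  face_sum S e c = \sum_(i < n | (0 < gexp e i)%N) \sum_(j in S i)
    face_coef e i j *
    ((gexp c == gexp e - U_(i))%MM && (gset c == gset e :\ j))%:R.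
Proof.
rewrite /face_sum sum_ffunE; apply: eq_bigr => i _.
by rewrite sum_ffunE; apply: eq_bigr => j _; rewrite !ffunE.
Qed.

Lemma face_sum_face ell S (e : EN_gen n m ell.+1) c i j :
  (forall i, S i \subset gset e) -> is_face e c i j ->
  face_sum S e c = if j \in S i then face_coef e i j else 0.
Proof.
move=> sub F; have [ai jI ca cI] := F; rewrite face_sumE.
(* A second contributing pair would make [c] a face in two ways, against [face_inj]. *)
have zero i' j' : (0 < gexp e i')%N -> j' \in S i' -> (i' != i) || (j' != j) ->
    face_coef e i' j' *
    ((gexp c == gexp e - U_(i'))%MM && (gset c == gset e :\ j'))%:R = 0.
  move=> ai' jS ne; case: eqP => ca' /=; last by rewrite mulr0.
  case: eqP => cI' /=; last by rewrite mulr0.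
  have [] // := @face_inj _ e c i' j' i j.
    by split=> //; apply: (subsetP (sub i')).
  by move=> ei ej; rewrite ei ej !eqxx in ne.
rewrite (bigD1 i) //= [X in _ + X]big1 ?addr0; last first.
  by move=> i' /andP[ai' ne]; rewrite big1 // => j' jS; rewrite zero ?ne.
case: ifP => jS; last first.
  rewrite big1 // => j' jS'; rewrite zero //; apply/orP; right.
  by apply: contraFneq jS => <-.
rewrite (bigD1 j) //= big1 ?addr0; last first.
  by move=> j' /andP[jS' ne]; rewrite zero // ne orbT.
by rewrite ca cI !eqxx mulr1.
Qed.

Lemma face_sum_nface ell S (e : EN_gen n m ell.+1) c :
  (forall i, S i \subset gset e) -> (forall i j, ~ is_face e c i j) ->
  face_sum S e c = 0.
Proof.
move=> sub F; rewrite face_sumE big1 // => i ai; rewrite big1 // => j jS.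
case: andP => [[/eqP ca /eqP cI]|]; last by rewrite mulr0.
by case: (F i j); split=> //; apply: (subsetP (sub i)).
Qed.

(** The coefficient of the variable is 1 or -1, nonzero in every field; the sign is irrelevant for
    supports. *)
Lemma mcoeff_face_coef ell (e : EN_gen n m ell) i j u :
  ((face_coef e i j)@_u != 0) = (u == U_(mxvec_index i j)%MM).
Proof.
rewrite /face_coef /sgn /xvar -signr_odd mulr_sign.
rewrite [RHS]eq_sym; case: odd; rewrite ?mcoeffN ?oppr_eq0 mcoeffX.
  by case: (_ == u); rewrite ?oner_eq0 ?eqxx.
by case: (_ == u); rewrite ?oner_eq0 ?eqxx.
Qed.

Lemma EN_d_basisS ell (e : EN_gen n m ell.+1) :
  EN_d_basis k (e : EN_basis n m ell.+2) = face_sum (fun=> gset e) e.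
Proof. by []. Qed.

Lemma msupp_EN_d_basisP ell (e : EN_gen n m ell.+1) c u :
  u \in msupp (EN_d_basis k (e : EN_basis n m ell.+2) c : {mpoly k[n * m]}) <->
  exists i j, is_face e c i j /\ u = U_(mxvec_index i j)%MM.
Proof.
rewrite EN_d_basisS mcoeff_msupp; split.
  move=> nz.
  (* The boolean form of [is_face] over finite index types allows the case distinction. *)
  have [/existsP[i /existsP[j /and4P[ai jI /eqP ca /eqP cI]]]|N] :=
    boolP [exists i, [exists j, [&& (0 < gexp e i)%N, j \in gset e,
      gexp c == (gexp e - U_(i))%MM & gset c == gset e :\ j]]].
    have F : is_face e c i j by [].
    exists i, j; split=> //; move: nz; rewrite (face_sum_face _ F) // jI.
    by rewrite mcoeff_face_coef => /eqP.
  move: nz; rewrite face_sum_nface ?mcoeff0 ?eqxx // => i j [ai jI ca cI].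
  move/existsP: N; apply; exists i; apply/existsP; exists j.
  by rewrite ai jI ca cI !eqxx.
case=> i [j [F ->]]; rewrite (face_sum_face _ F) //.
by have [_ -> _ _] := F; rewrite mcoeff_face_coef.
Qed.

End Generators.

(** * The support of a maximal minor *)

Section Minor.
Variables (k : fieldType) (n m : nat) (I : {set 'I_m}) (cI : #|I| = n).
Implicit Types (i c : 'I_n) (s : {perm 'I_n}).

Definition column c : 'I_m := enum_val (cast_ord (esym cI) c).

Lemma column_inj : injective column.
Proof. by move=> c c' /enum_val_inj /cast_ord_inj. Qed.

Lemma column_in c : column c \in I.
Proof. exact: enum_valP. Qed.

Lemma column_surj j : j \in I -> exists c, column c = j.
Proof.
move=> jI; exists (cast_ord cI (enum_rank_in jI j)).
by rewrite /column cast_ordK enum_rankK_in.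
Qed.

(** The Leibniz term of [s] as a placement: row [i] receives the single column [column (s i)]. *)
Definition perm_placement s : placement n m :=
  [ffun j => [pick i | column (s i) == j]].

Lemma perm_placementE s j i :
  (perm_placement s j == Some i) = (column (s i) == j).
Proof.
rewrite ffunE; case: pickP => [i' /eqP <-|->]; last by [].
by rewrite (inj_eq Some_inj) (inj_eq column_inj) (inj_eq perm_inj) eq_sym.
Qed.

Lemma fiber_perm_placement s i : fiber (perm_placement s) i = [set column (s i)].
Proof. by apply/setP => j; rewrite !inE perm_placementE eq_sym. Qed.

Lemma pmon_perm_placement s :
  pmon (perm_placement s) = (\sum_(i < n) U_(mxvec_index i (column (s i))))%MM.
Proof.
by apply: eq_bigr => i _; rewrite fiber_perm_placement big_set1.
Qed.

Lemma perm_placement_inj : injective perm_placement.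
Proof.
move=> s s' E; apply/permP => i; apply: column_inj; apply/esym/eqP.
by rewrite -perm_placementE -E perm_placementE.
Qed.

Lemma admissible_perm_placement s : admissible 0%MM I (perm_placement s).
Proof.
split=> [|i]; last by rewrite fiber_perm_placement cards1 mnm0E.
rewrite -bigcup_fiber; apply/setP => j; apply/bigcupP/idP => [[i _]|jI].
  by rewrite fiber_perm_placement inE => /eqP->; apply: column_in.
have [c <-] := column_surj jI; exists (s^-1%g c) => //.
by rewrite fiber_perm_placement inE permKV.
Qed.

(** For a = 0 all fibres are singletons. Choosing their elements gives a map from rows to columns,
    injective because [f] sends a column to only one row, hence a permutation. *)
Lemma admissible0P (f : placement n m) :
  admissible 0%MM I f -> exists s, f = perm_placement s.
Proof.
case=> dom cnt.
have /fin_all_exists[t tP] i : exists c, fiber f i = [set column c].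
  have /eqP/cards1P[j fj] : #|fiber f i| = 1%N by rewrite cnt mnm0E.
  have jI : j \in I.
    by rewrite -dom; apply: (subsetP (fiber_sub_pdom f i)); rewrite fj set11.
  by have [c cj] := column_surj jI; exists c; rewrite cj.
have ft i : f (column (t i)) = Some i.
  by apply/eqP; have := set11 (column (t i)); rewrite -tP inE.
have t_inj : injective t by move=> i i' E; apply: Some_inj; rewrite -!ft E.
exists (perm t_inj); apply: pmon_inj; rewrite pmon_perm_placement.
by apply: eq_bigr => i _; rewrite tP big_set1 permE.
Qed.

Lemma maxminorE :
  maxminor k n I = \sum_(s : {perm 'I_n}) (-1) ^+ s *: 'X_[pmon (perm_placement s)].
Proof.
apply: eq_bigr => s _; rewrite scaler_sign mulr_sign pmon_perm_placement -mprodXE.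
set P := \prod_i _; set Q := \prod_i _; have -> // : P = Q.
apply: eq_bigr => i _; rewrite mxE.
(* The index is in range, so the default value in the definition of [maxminor] never appears. *)
have lt : (s i < size (enum I))%N by rewrite -cardE cI.
rewrite (nth_map (column i)) // mxE; rewrite /xvar; congr mpolyX; congr mnm1; congr mxvec_index.
exact: esym (enum_val_nth (column i) (cast_ord (esym cI) (s i))).
Qed.

(** Different permutations have different monomials, so nothing cancels in the Leibniz expansion. *)
Lemma mem_msupp_maxminor u :
  u \in msupp (maxminor k n I) <->
  exists2 f, admissible 0%MM I f & u = pmon f.
Proof.
rewrite mcoeff_msupp maxminorE raddf_sum /=.
under eq_bigr do rewrite mcoeffZ mcoeffX.
split=> [nz|[f /admissible0P[s ->] ->]].
  have [/existsP[s /eqP us]|N] := boolP [exists s, u == pmon (perm_placement s)].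
    by exists (perm_placement s) => //; apply: admissible_perm_placement.
  rewrite big1 ?eqxx // in nz => s _.
  case: eqP => [su|]; last by rewrite mulr0.
  by case/existsP: N; exists s; rewrite su.
rewrite (bigD1 s) //= eqxx big1 => [|s' ne].
  by rewrite addr0 mulr1 signr_eq0.
case: eqP => [/pmon_inj/perm_placement_inj E|]; last by rewrite mulr0.
by rewrite E eqxx in ne.
Qed.

End Minor.

(** * Multidegrees as largest placement monomials, and the sparse differential *)

Section Multidegrees.
Variables (k : fieldType) (n m : nat) (le : rel 'X_{1..n * m}).
Hypothesis hle : term_order le.

Definition is_top a (I : {set 'I_m}) (f : placement n m) :=
  admissible a I f /\ forall g, admissible a I g -> le (pmon g) (pmon f).

Lemma admissible_top a I (f : placement n m) :
  admissible a I f -> exists g, is_top a I g.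
Proof.
move=> Pf.
pose adm g := (pdom g == I) && [forall i, #|fiber g i| == (a i).+1].
have admP g : reflect (admissible a I g) (adm g).
  by apply: (iffP andP) => [[/eqP ? /'forall_eqP ?]|[/eqP ? /'forall_eqP ?]].
pose s := [seq g <- enum {: placement n m} | adm g].
have sP g : reflect (admissible a I g) (g \in s).
  by rewrite mem_filter mem_enum andbT; apply: admP.
have ub := term_order_refl hle (\big[mmax le/0%MM]_(g <- s) pmon g).
rewrite {1}bigmmax_le // in ub; move/allP: ub => ub.
case: (bigmmax_attained le s (@pmon n m)) => [E|[g /sP Pg E]].
  (* If the maximum is the starting value 1, all admissible monomials are at most 1, and the given
     [f] is already on top. *)
  exists f; split=> // g /sP/ub; rewrite E => g0.
  exact: (term_order_trans hle g0 (term_order_ge0 hle _)).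
by exists g; split=> // h /sP/ub; rewrite E.
Qed.

Lemma face_pmon_place ell (e : EN_gen n m ell.+1) c i j g :
  is_face e c i j -> admissible (gexp c) (gset c) g ->
  admissible (gexp e) (gset e) (place g i j) /\
  pmon (place g i j) = (U_(mxvec_index i j) + pmon g)%MM.
Proof.
case=> ai jI ca cI; rewrite ca cI => Pg.
split; first exact: admissible_place.
apply: pmon_place; case: Pg => dom _.
have: (j \in pdom g) = (j \in gset e :\ j) by rewrite dom.
by rewrite !inE eqxx; case: (g j).
Qed.

Lemma face_top_le ell (e : EN_gen n m ell.+1) c i j f g :
  is_face e c i j -> is_top (gexp e) (gset e) f -> is_top (gexp c) (gset c) g ->
  le (U_(mxvec_index i j) + pmon g)%MM (pmon f).
Proof.
by move=> F [_ top] [/(face_pmon_place F)[Pp <-] _]; apply: top.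
Qed.

(** If the monomials agree, [pmon_inj] gives [place g i j = f], so [f] sends [j] to [i]. Conversely,
    removing [j] from [f] leaves a placement admissible for [c], hence below [g]; multiplying by
    x_ij gives the inequality opposite to [face_top_le]. *)
Lemma face_top_eq ell (e : EN_gen n m ell.+1) c i j f g :
  is_face e c i j -> is_top (gexp e) (gset e) f -> is_top (gexp c) (gset c) g ->
  ((U_(mxvec_index i j) + pmon g)%MM == pmon f) = (j \in fiber f i).
Proof.
move=> F tf tg; rewrite inE; apply/eqP/eqP => [E|fj].
  have [Pg _] := tg; have [_ Ep] := face_pmon_place F Pg.
  by move: E; rewrite -Ep => /pmon_inj <-; rewrite ffunE eqxx.
apply: (term_order_anti hle); first exact: face_top_le F tf tg.
rewrite -(pmon_unplace fj) ![(U_(_) + _)%MM]addmC.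
apply: (term_order_add2r hle); case: F => ai jI ca cI; case: tg => _; apply.
by rewrite ca cI; apply: admissible_unplace => //; case: tf.
Qed.

Lemma EN_mdeg_top ell (e : EN_gen n m ell) :
  exists2 f, is_top (gexp e) (gset e) f &
    EN_mdeg k le (e : EN_basis n m ell.+1) = pmon f.
Proof.
elim: ell e => [|ell IHell] e.
  have cI : #|gset e| = n by rewrite card_gset addn0.
  have a0 : gexp e = 0%MM by apply/eqP; rewrite -mdeg_eq0 mdeg_gexp.
  (* The identity permutation only witnesses that some placement is admissible. *)
  have [f [Pf top]] := admissible_top (admissible_perm_placement cI 1%g).
  exists f; first by rewrite a0.
  have vE : (EN_d_basis k (e : EN_basis n m 1) tt : {mpoly k[n * m]}) =
      maxminor k n (gset e) by rewrite /= !ffunE; apply: mulr1.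
  apply: (vmdegP hle) => [|[] u].
    exists tt, (pmon f); rewrite vE addm0; split=> //.
    by apply/mem_msupp_maxminor => //; exists f.
  rewrite vE addm0 => /(mem_msupp_maxminor k cI)[g Pg ->]; exact: top.
(* Any face of [e] will do here: filling in a placement from the induction hypothesis shows that [e]
   has an admissible one, hence a top one [f]. *)
have [i ai] : exists i, (0 < gexp e i)%N.
  apply/existsP; apply: contraT => /existsPn N.
  have /eqP := mdeg_gexp e; rewrite mdegE big1 // => i _.
  by have := N i; rewrite -eqn0Ngt => /eqP.
have [j jI] : exists j, j \in gset e.
  by apply/set0Pn; rewrite -card_gt0 card_gset addnS.
have [c F] := face_ex ai jI.
have [g [Pg _] _] := IHell c.
have [Pp _] := face_pmon_place F Pg.
have [f tf] := admissible_top Pp; exists f => //.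
rewrite -[LHS]/(vmdeg le (@EN_mdeg k n m le ell.+1) (@EN_d_basis k n m ell.+1 e)).
apply: (vmdegP hle) => [|c' u].
  (* To attain the maximum the column must lie in b_i, which the earlier [j] need not do. *)
  have [j' jf] : exists j', j' \in fiber f i.
    by apply/set0Pn; rewrite -card_gt0 (proj2 (proj1 tf)).
  have jI' : j' \in gset e.
    by rewrite -(proj1 (proj1 tf)); apply: (subsetP (fiber_sub_pdom f i)).
  have [c' F'] := face_ex ai jI'; have [h th Eh] := IHell c'.
  exists c', U_(mxvec_index i j')%MM; split.
    by apply/msupp_EN_d_basisP; exists i, j'.
  by rewrite Eh; apply/esym/eqP; rewrite (face_top_eq F' tf th).
move=> /msupp_EN_d_basisP[i' [j' [F' ->]]].
have [h th ->] := IHell c'; exact: face_top_le F' tf th.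
Qed.

Lemma linext_EN_vec ell C (D : EN_gen n m ell -> freemod {mpoly k[n * m]} C) e :
  linext D (EN_vec k ell (gexp e) (gset e)) = D e.
Proof.
rewrite /linext (bigD1 e) //= big1 ?addr0 => [|e' ne].
  by rewrite ffunE !eqxx scale1r.
rewrite ffunE; case: eqP => [Ea|]; last by rewrite scale0r.
case: eqP => [EI|]; last by rewrite scale0r.
by rewrite (EN_gen_inj Ea EI) eqxx in ne.
Qed.

(** At a face only the monomial x_ij has a nonzero coefficient, and [face_top_eq] says that it
    survives exactly when [j] lies in b_i; at all other basis elements both sides vanish. *)
Lemma vinit_EN_d_basis ell (e : EN_gen n m ell.+1) f :
  is_top (gexp e) (gset e) f ->
  EN_mdeg k le (e : EN_basis n m ell.+2) = pmon f ->
  vinit le (@EN_mdeg k n m le ell.+1) (EN_d_basis k (e : EN_basis n m ell.+2)) =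
  face_sum k (fiber f) e.
Proof.
move=> tf Ef; apply/ffunP => c; apply/mpolyP => u.
have sub i : fiber f i \subset gset e.
  by rewrite -(proj1 (proj1 tf)); apply: fiber_sub_pdom.
rewrite mcoeff_vinit -[vmdeg _ _ _]/(EN_mdeg k le (e : EN_basis n m ell.+2)) Ef.
rewrite EN_d_basisS.
have [h th ->] := EN_mdeg_top c.
have [/existsP[i /existsP[j /and4P[ai jI /eqP ca /eqP cI]]]|N] :=
  boolP [exists i, [exists j, [&& (0 < gexp e i)%N, j \in gset e,
    gexp c == (gexp e - U_(i))%MM & gset c == gset e :\ j]]].
  have F : is_face e c i j by [].
  rewrite !(face_sum_face _ _ F) // jI.
  have [->|ne] := eqVneq u U_(mxvec_index i j)%MM.
    by rewrite (face_top_eq F tf th); case: ifP; rewrite ?mcoeff0.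
  have z : (face_coef k e i j)@_u = 0.
    by apply/eqP; rewrite -[_ == _]negbK mcoeff_face_coef.
  by rewrite z if_same; case: ifP; rewrite ?mcoeff0.
have nF i j : ~ is_face e c i j.
  case=> ai jI ca cI; move/existsP: N; apply.
  by exists i; apply/existsP; exists j; rewrite ai jI ca cI !eqxx.
by rewrite !face_sum_nface // mcoeff0 if_same.
Qed.

Lemma vinit_EN_d_basis0 (e : EN_gen n m 0) :
  vinit le (@EN_mdeg k n m le 0) (EN_d_basis k (e : EN_basis n m 1)) =
  lterm le (maxminor k n (gset e)) *: EN_one k n m.
Proof.
set p := maxminor k n (gset e).
have vE : (EN_d_basis k (e : EN_basis n m 1) tt : {mpoly k[n * m]}) = p.
  by rewrite /= !ffunE; apply: mulr1.
have dE : vmdeg le (@EN_mdeg k n m le 0) (EN_d_basis k (e : EN_basis n m 1)) =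
    lmon le p.
  (* [E_0] has one basis element, of multidegree 1, so the outer maximum collapses and the inner one
     is the lead monomial. *)
  have enum1 : index_enum (EN_basis n m 0) = [:: tt].
    by rewrite /index_enum /= unlock.
  rewrite /vmdeg enum1 big_cons big_nil (mmaxu0 hle) vE.
  by apply: eq_bigr => u _; rewrite addm0.
apply/ffunP => -[]; apply/mpolyP => u; rewrite mcoeff_vinit dE vE addm0.
have -> : (lterm le p *: EN_one k n m) tt = lterm le p.
  by rewrite !ffunE; apply: mulr1.
rewrite mcoeffZ mcoeffX eq_sym.
by case: eqP => [->|]; rewrite ?mulr1 ?mulr0.
Qed.

End Multidegrees.

Theorem theorem2p16 (k : fieldType) (n m : nat) (hnm : (n <= m)%N)
    (le : rel 'X_{1..n * m}) (hle : term_order le) :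
  (forall (ell : nat) (e : EN_gen n m ell.+1),
     exists b : 'I_n -> {set 'I_m},
       [/\ (forall i i' : 'I_n, i != i' -> [disjoint b i & b i']),
           \bigcup_(i < n) b i = gset e,
           (forall i : 'I_n, #|b i| = (gexp e i).+1),
           'X_[@EN_mdeg k n m le ell.+2 e] =
             \prod_(i < n) \prod_(j in b i) xvar k i j &
           sEN_d le (EN_vec k ell.+1 (gexp e) (gset e)) =
             \sum_(i < n | (0 < gexp e i)%N) \sum_(j in b i)
               (sgn k n j (gset e) * xvar k i j) *:
                 EN_vec k ell (gexp e - U_(i))%MM (gset e :\ j)])
  /\
  (forall e : EN_gen n m 0,
     sEN_d le (EN_vec k 0 (gexp e) (gset e)) =
       lterm le (maxminor k n (gset e)) *: EN_one k n m).
Proof.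
split=> [ell e|e]; last first.
  by rewrite /sEN_d linext_EN_vec vinit_EN_d_basis0.
have [f tf Ef] := EN_mdeg_top k hle e; have [[dom cnt] _] := tf.
(* The b_i are the fibres of the top placement, whose monomial is the multidegree. *)
exists (fiber f); split=> //.
- exact: disjoint_fiber.
- by rewrite bigcup_fiber.
- rewrite Ef -mprodXE; apply: eq_bigr => i _; by rewrite -mprodXE.
by rewrite /sEN_d linext_EN_vec (vinit_EN_d_basis hle tf Ef).
Qed.
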